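(* Let $(\alpha_0,\alpha_1,\alpha_2,\alpha_3)$ be a rotation quadrangle (in the generic sense described in the context), with relative revolute axes $r_{01}, r_{12}, r_{23}, r_{30}$ in the moving space and relative rotation angles $\omega_{01},\omega_{12},\omega_{23},\omega_{30}$. For any index $i$ (indices modulo four), the rotation quadrangle is uniquely determined by either of the following sets of data: (1) the displacement $\alpha_i$, the three revolute axes $r_{i,i+1}$, $r_{i+1,i+2}$, $r_{i+2,i+3}$, and the two rotation angles $\omega_{i,i+1}$ and $\omega_{i+1,i+2}$; (2) the two displacements $\alpha_i$, $\alpha_{i+2}$ and the two relative revolute axes $r_{i,i+1}$, $r_{i+2,i+3}$.
   Context: A displacement is a proper (orientation-preserving) Euclidean motion of three-space, viewed as a map $\alpha$ from a moving space to a fixed space, both copies of Euclidean three-space. Indices are taken modulo four. For four displacements $\alpha_0,\alpha_1,\alpha_2,\alpha_3$ the relative displacements of consecutive positions are $\tau_{i,i+1}=\alpha_{i+1}\circ\alpha_i^{-1}$. The quadruple $(\alpha_0,\alpha_1,\alpha_2,\alpha_3)$ is called a rotation quadrangle (or rotation quadrilateral) if each of $\tau_{01},\tau_{12},\tau_{23},\tau_{30}$ is a pure rotation (about some line). The relative revolute axis $r_{i,i+1}$ in the moving space is the line of points $X$ with $\alpha_i(X)=\alpha_{i+1}(X)$; equivalently, $\alpha_i(r_{i,i+1})=\alpha_{i+1}(r_{i,i+1})$ is the axis of $\tau_{i,i+1}$. The angle $\omega_{i,i+1}$ is the rotation angle of this relative rotation, measured with respect to an orientation of the axis, so that $\alpha_i^{-1}\circ\alpha_{i+1}$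 is the rotation about $r_{i,i+1}$ through $\omega_{i,i+1}$. Standing genericity assumption: Study's kinematic mapping represents a displacement by a unit dual quaternion $x+\epsilon y$ up to nonzero real scalar factor, i.e. by a point $[x_0:\dots:x_3:y_0:\dots:y_3]$ of the Study quadric $\mathcal{S}=\{x_0y_0+x_1y_1+x_2y_2+x_3y_3=0\}$ in real projective space $P^7$ (with $x\neq 0$). Let $A_i\in\mathcal{S}$ be the image of $\alpha_i$. For a rotation quadrangle the lines $A_iA_{i+1}$ lie in $\mathcal{S}$. It is assumed throughout that the quadrilateral $A_0A_1A_2A_3$ spans a three-dimensional projective subspace that is not completely contained in $\mathcal{S}$.
   Formalization: Adds that the diagonal line joining A_i and A_{i+2} is not contained in the Study quadric; the stated genericity does not imply this, and without it the remaining position can be varied freely, so uniqueness fails. *)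

(* Defs.v *)
From HB Require Import structures.
From mathcomp Require Import all_boot all_order all_algebra.
From mathcomp Require Import classical_sets reals trigo.

Set Implicit Arguments.
Unset Strict Implicit.
Unset Printing Implicit Defensive.

Import Order.TTheory GRing.Theory Num.Theory.
Local Open Scope ring_scope.
Local Open Scope classical_set_scope.

Section Vectors.
Variable R : realType.

Definition dot n (u v : 'rV[R]_n) : R := \sum_k u 0 k * v 0 k.

(* Indices of 'I_3 are added modulo 3. *)
Definition cross (u v : 'rV[R]_3) : 'rV[R]_3 :=
  \row_k (u 0 (k + 1) * v 0 (k + 2%:R) - u 0 (k + 2%:R) * v 0 (k + 1)).

Definition line (p u : 'rV[R]_3) : set 'rV[R]_3 :=
  [set x | exists t : R, x = p + t *: u].

(* Rodrigues' formula: rotation through the angle w about the line through p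
   oriented by the unit vector u. *)
Definition rotation (p u : 'rV[R]_3) (w : R) (x : 'rV[R]_3) : 'rV[R]_3 :=
  p + cos w *: (x - p) + sin w *: cross u (x - p)
    + ((1 - cos w) * dot u (x - p)) *: u.

End Vectors.

(* Proper Euclidean motions of three-space; points are row vectors, so that the
   linear part acts on the right. *)
Record displacement (R : realType) := Displacement {
  dlin : 'M[R]_3;
  dtrans : 'rV[R]_3;
  dlin_orth : dlin *m dlin^T == 1%:M;
  dlin_det : \det dlin == 1
}.

Definition dapp (R : realType) (a : displacement R) (x : 'rV[R]_3) : 'rV[R]_3 :=
  x *m dlin a + dtrans a.
Coercion dapp : displacement >-> Funclass.

Section DisplacementGroup.
Variable R : realType.
Implicit Types a b : displacement R.

Fact dcomp_orth a b : dlin b *m dlin a *m (dlin b *m dlin a)^T == 1%:M.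
Proof.
rewrite trmx_mul mulmxA -(mulmxA _ (dlin a)) (eqP (dlin_orth a)) mulmx1.
exact: dlin_orth.
Qed.

Fact dcomp_det a b : \det (dlin b *m dlin a) == 1.
Proof. by rewrite det_mulmx (eqP (dlin_det a)) (eqP (dlin_det b)) mulr1. Qed.

Definition dcomp a b : displacement R :=
  @Displacement R _ (dtrans b *m dlin a + dtrans a)
    (dcomp_orth a b) (dcomp_det a b).

Lemma dcompE a b x : dcomp a b x = a (b x).
Proof. by rewrite /dapp /= mulmxDl addrA mulmxA. Qed.

Fact dinv_orth a : (dlin a)^T *m (dlin a)^T^T == 1%:M.
Proof. by rewrite trmxK (mulmx1C (eqP (dlin_orth a))). Qed.

Fact dinv_det a : \det (dlin a)^T == 1.
Proof. by rewrite det_tr dlin_det. Qed.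

Definition dinv a : displacement R :=
  @Displacement R _ (- (dtrans a *m (dlin a)^T)) (dinv_orth a) (dinv_det a).

Lemma dinvK a x : a (dinv a x) = x.
Proof.
rewrite /dapp /= mulmxDl -mulmxA (mulmx1C (eqP (dlin_orth a))) mulmx1 mulNmx.
by rewrite -mulmxA (mulmx1C (eqP (dlin_orth a))) mulmx1 addrNK.
Qed.

Lemma dinvKV a x : dinv a (a x) = x.
Proof.
rewrite /dapp /= mulmxDl -mulmxA (eqP (dlin_orth a)) mulmx1.
by rewrite addrK.
Qed.

(* The identity is not a pure rotation: it has no well-defined axis. *)
Definition pure_rotation a : Prop :=
  exists (p u : 'rV[R]_3) (w : R),
    [/\ dot u u = 1, cos w <> 1 & forall x, a x = rotation p u w x].

End DisplacementGroup.

Section Study.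
Variable R : realType.

(* The quaternion s + v1 i + v2 j + v3 k is the row vector (s, v1, v2, v3). *)
Definition quat (s : R) (v : 'rV[R]_3) : 'rV[R]_4 :=
  \row_k (if unlift ord0 k is Some j then v 0 j else s).
Definition qre (q : 'rV[R]_4) : R := q 0 ord0.
Definition qim (q : 'rV[R]_4) : 'rV[R]_3 := \row_j q 0 (lift ord0 j).
Definition qconj (q : 'rV[R]_4) : 'rV[R]_4 := quat (qre q) (- qim q).
Definition qmul (p q : 'rV[R]_4) : 'rV[R]_4 :=
  quat (qre p * qre q - dot (qim p) (qim q))
       (qre p *: qim q + qre q *: qim p + cross (qim p) (qim q)).

(* Points of P^7 are given by their homogeneous coordinates
   [x_0 : ... : x_3 : y_0 : ... : y_3]. *)
Definition study_form (v : 'rV[R]_(4 + 4)) : R := dot (lsubmx v) (rsubmx v).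

(* v is a coordinate vector of the image of a under Study's kinematic mapping.
   The unit dual quaternion x + eps y acts by
     1 + eps p |-> (x + eps y) (1 + eps p) (x^* - eps y^* ),
   whose eps-part is x p x^* + y x^* - x y^*  =  x p x^* + 2 y x^*, because the
   real part of y x^* is dot x y = 0. *)
Definition study_image (a : displacement R) (v : 'rV[R]_(4 + 4)) : Prop :=
  exists (c : R) (x y : 'rV[R]_4),
    [/\ c != 0, v = c *: row_mx x y, dot x x = 1, dot x y = 0 &
      forall p : 'rV[R]_3,
        quat 0 (a p) =
          qmul (qmul x (quat 0 p)) (qconj x) + 2%:R *: qmul y (qconj x)].

Definition in_study_quadric m (M : 'M[R]_(m, 4 + 4)) : Prop :=
  forall v : 'rV[R]_(4 + 4), (v <= M)%MS -> study_form v = 0.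

(* The line joining the kinematic images of a and b lies in the Study quadric;
   equivalently, the displacement of b relative to a is a rotation or a
   translation.  This always holds for consecutive positions of a rotation
   quadrangle, but for opposite positions it is not excluded by
   generic_quadrangle: when one diagonal lies in the quadric and the other one
   does not, the span of the quadrilateral meets the quadric in two planes.
   Then, if alpha_i and alpha_{i+2} are opposite positions on the diagonal lying
   in the quadric, alpha_{i+3} can be rotated freely about r_{i+2,i+3} relative
   to alpha_{i+2} and its displacement relative to alpha_i generically remains a
   rotation. *)
Definition join_in_study_quadric (a b : displacement R) : Prop :=
  forall v w : 'rV[R]_(4 + 4), study_image a v -> study_image b w ->
    in_study_quadric (col_mx v w).

End Study.

Section RotationQuadrangle.
Variable R : realType.
(* The type 'I_4 carries addition modulo 4. *)
Implicit Types (alpha : 'I_4 -> displacement R) (i : 'I_4).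

Definition relative_displacement alpha i : displacement R :=
  dcomp (alpha (i + 1)) (dinv (alpha i)).

(* Projective dimension three is rank four. *)
Definition generic_quadrangle alpha : Prop :=
  exists A : 'I_4 -> 'rV[R]_(4 + 4),
    [/\ forall i, study_image (alpha i) (A i),
        \rank (\matrix_(i < 4) A i) = 4%N
      & ~ in_study_quadric (\matrix_(i < 4) A i)].

Definition rotation_quadrangle alpha : Prop :=
  (forall i, pure_rotation (relative_displacement alpha i)) /\
  generic_quadrangle alpha.

(* The axis r_{i,i+1} in the moving space; it is a line when the relative
   displacement is a pure rotation. *)
Definition revolute_axis alpha i : set 'rV[R]_3 :=
  [set X | alpha i X = alpha (i + 1) X].

(* w is (a representative modulo 2 pi of) omega_{i,i+1}, with respect to the
   orientation of r_{i,i+1} by the unit vector u. *)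
Definition rotation_angle alpha i (u : 'rV[R]_3) (w : R) : Prop :=
  dot u u = 1 /\
  exists p : 'rV[R]_3,
    revolute_axis alpha i = line p u /\
    forall x, dcomp (dinv (alpha i)) (alpha (i + 1)) x = rotation p u w x.

End RotationQuadrangle.

(* Main.v *)
Require Import Defs.
From mathcomp Require Import all_boot all_order all_algebra.
From mathcomp Require Import boolp classical_sets reals trigo.
From mathcomp Require Import ring.

Set Implicit Arguments.
Unset Strict Implicit.
Unset Printing Implicit Defensive.

Import Order.TTheory GRing.Theory Num.Theory.
Local Open Scope ring_scope.

(** The theorem reduces to one fact about four displacements.  Suppose that the
    positions b and c, and likewise b and c', agree along a line, that a and c
    share a point, as do a and c', and that the join of the Study images of a
    and b is not contained in the Study quadric.  Then c = c'.  This is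
    [revolute_position_unique].

    Write B for the polar form of the Study quadric.  A displacement a with
    dual quaternion x + eps y is characterised by the identity
    (a X) x = x X + 2 y for all X, which is linear in the pair (x, y).  Two
    consequences of this linearity carry the argument.
    - If two displacements take a common value at some point X, multiply each
      of the two identities at X scalarly with the quaternion x of the other
      displacement and add.  Only B = 0 is left, because multiplication by a
      pure quaternion is skew-symmetric ([common_point_polar0]).
    - If b has the dual quaternion g, the displacements that agree with b along
      the line through p with direction u have dual quaternions in the pencil
      s g + t g h with s^2 + t^2 = 1, where h = u + eps (cross p u) is the dual
      vector of the line ([dual_quaternion_pencil]).

    So c and c' correspond to points of one line through the image of b, and
    both are conjugate to a with respect to B.  As B (a, b) is nonzero, the
    polar hyperplane of a meets this line in a single point, hence c = c'.

    In a rotation quadrangle, consecutive positions agree along their revolute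
    axis.  For the second set of data, this fact determines each of the two
    unknown positions from the two given ones.  For the first set, the two given
    rotations lead from alpha_i to alpha_{i+1} and alpha_{i+2}, and the same
    fact then gives alpha_{i+3}. *)

(** * Vectors of three-space and quaternions in coordinates *)

Section Coordinates.
Variable R : realType.
Implicit Types (u v : 'rV[R]_3) (q : 'rV[R]_4) (s t : R).

Lemma dot3E u v :
  dot u v = u 0 0 * v 0 0 + u 0 1 * v 0 1 + u 0 2%:R * v 0 2%:R.
Proof.
rewrite /dot !big_ord_recr big_ord0 /= add0r.
by congr (u 0 _ * v 0 _ + u 0 _ * v 0 _ + u 0 _ * v 0 _); apply/val_inj.
Qed.

Lemma row3P u v :
  u 0 0 = v 0 0 -> u 0 1 = v 0 1 -> u 0 2%:R = v 0 2%:R -> u = v.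
Proof.
move=> e0 e1 e2; apply/rowP => -[[|[|[|//]]] lt_k3].
- by rewrite (_ : Ordinal lt_k3 = 0) //; apply/val_inj.
- by rewrite (_ : Ordinal lt_k3 = 1) //; apply/val_inj.
- by rewrite (_ : Ordinal lt_k3 = 2%:R) //; apply/val_inj.
Qed.

Lemma cross3E u v :
  (cross u v 0 0 = u 0 1 * v 0 2%:R - u 0 2%:R * v 0 1) *
  (cross u v 0 1 = u 0 2%:R * v 0 0 - u 0 0 * v 0 2%:R) *
  (cross u v 0 2%:R = u 0 0 * v 0 1 - u 0 1 * v 0 0).
Proof.
by split; [split|]; rewrite mxE;
  congr (u 0 _ * v 0 _ - u 0 _ * v 0 _); apply/val_inj.
Qed.

Lemma qre_quat s v : qre (quat s v) = s.
Proof. by rewrite /qre mxE unlift_none. Qed.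

Lemma qim_quat s v : qim (quat s v) = v.
Proof. by apply/rowP => j; rewrite !mxE liftK. Qed.

Lemma quat_eta q : q = quat (qre q) (qim q).
Proof.
apply/rowP => k; rewrite !mxE; case: unliftP => [j ->|->] //.
by rewrite mxE.
Qed.

Lemma dot_quat s t u v : dot (quat s u) (quat t v) = s * t + dot u v.
Proof.
rewrite /dot big_ord_recl !mxE unlift_none; congr (_ + _).
by apply: eq_bigr => j _; rewrite !mxE liftK.
Qed.

Lemma qmul_quat s t u v :
  qmul (quat s u) (quat t v) =
  quat (s * t - dot u v) (s *: v + t *: u + cross u v).
Proof. by rewrite /qmul !qre_quat !qim_quat. Qed.

Lemma quatD s t u v : quat s u + quat t v = quat (s + t) (u + v).
Proof.
by apply/rowP => k; rewrite !mxE; case: unlift => [j|] //; rewrite mxE.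
Qed.

Lemma quatZ s t v : s *: quat t v = quat (s * t) (s *: v).
Proof.
by apply/rowP => k; rewrite !mxE; case: unlift => [j|] //; rewrite mxE.
Qed.

Lemma quatN t v : - quat t v = quat (- t) (- v).
Proof. by rewrite -scaleN1r quatZ mulN1r scaleN1r. Qed.

End Coordinates.

Ltac coord_ring := rewrite ?(dot3E, cross3E, mxE); ring.

Ltac quat_ring :=
  rewrite ?(qmul_quat, quatD, quatN, quatZ);
  congr quat; [|apply: row3P]; coord_ring.

Section Quaternions.
Variable R : realType.
Implicit Types (u v : 'rV[R]_3) (p q r x y z : 'rV[R]_4) (s t : R).

Lemma dotC4 x y : dot x y = dot y x.
Proof. by apply: eq_bigr => k _; rewrite mulrC. Qed.

Lemma dotDr4 x y z : dot x (y + z) = dot x y + dot x z.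
Proof.
by rewrite /dot -big_split; apply: eq_bigr => k _; rewrite mxE mulrDr.
Qed.

Lemma dotZr4 s x y : dot x (s *: y) = s * dot x y.
Proof.
by rewrite /dot big_distrr; apply: eq_bigr => k _; rewrite mxE mulrCA.
Qed.

Lemma dotDl4 x y z : dot (x + y) z = dot x z + dot y z.
Proof. by rewrite dotC4 dotDr4 !(dotC4 z). Qed.

Lemma dotZl4 s x y : dot (s *: x) y = s * dot x y.
Proof. by rewrite dotC4 dotZr4 dotC4. Qed.

Lemma qmulA p q r : qmul p (qmul q r) = qmul (qmul p q) r.
Proof. by rewrite (quat_eta p) (quat_eta q) (quat_eta r); quat_ring. Qed.

Lemma qmulDl p q r : qmul (p + q) r = qmul p r + qmul q r.
Proof. by rewrite (quat_eta p) (quat_eta q) (quat_eta r); quat_ring. Qed.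

Lemma qmulDr p q r : qmul p (q + r) = qmul p q + qmul p r.
Proof. by rewrite (quat_eta p) (quat_eta q) (quat_eta r); quat_ring. Qed.

Lemma qmulZl s p q : qmul (s *: p) q = s *: qmul p q.
Proof. by rewrite (quat_eta p) (quat_eta q); quat_ring. Qed.

Lemma qmulZr s p q : qmul p (s *: q) = s *: qmul p q.
Proof. by rewrite (quat_eta p) (quat_eta q); quat_ring. Qed.

Lemma qmul_scalarl s q : qmul (quat s 0) q = s *: q.
Proof. by rewrite (quat_eta q); quat_ring. Qed.

Lemma qmul_scalarr s q : qmul q (quat s 0) = s *: q.
Proof. by rewrite (quat_eta q); quat_ring. Qed.

Lemma qmul_conjl q : qmul (qconj q) q = quat (dot q q) 0.
Proof.
rewrite (quat_eta q) /qconj qre_quat qim_quat dot_quat; quat_ring.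
Qed.

Lemma qmul_conjr q : qmul q (qconj q) = quat (dot q q) 0.
Proof.
rewrite (quat_eta q) /qconj qre_quat qim_quat dot_quat; quat_ring.
Qed.

Lemma dot_qmul p q : dot (qmul p q) (qmul p q) = dot p p * dot q q.
Proof.
rewrite (quat_eta p) (quat_eta q) qmul_quat !dot_quat; coord_ring.
Qed.

Lemma dot_qmul_pure_left v x y :
  dot (qmul (quat 0 v) x) y = - dot x (qmul (quat 0 v) y).
Proof.
rewrite (quat_eta x) (quat_eta y) !qmul_quat !dot_quat; coord_ring.
Qed.

Lemma dot_qmul_pure_right v x y :
  dot (qmul x (quat 0 v)) y = - dot x (qmul y (quat 0 v)).
Proof.
rewrite (quat_eta x) (quat_eta y) !qmul_quat !dot_quat; coord_ring.
Qed.

(** The commutator of pure quaternions is where the moment of a line enters. *)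
Lemma commutator_pure u v :
  qmul (quat 0 u) (quat 0 v) =
  qmul (quat 0 v) (quat 0 u) + 2%:R *: quat 0 (cross u v).
Proof. by quat_ring. Qed.

Lemma quat_pureB u v : quat 0 (u - v) = quat 0 u - quat 0 v.
Proof. by rewrite quatN quatD subr0. Qed.

Lemma qmul_unit_inj x y z : dot x x = 1 -> qmul x y = qmul x z -> y = z.
Proof.
move=> x1 /(congr1 (qmul (qconj x))).
by rewrite !qmulA qmul_conjl x1 !qmul_scalarl !scale1r.
Qed.

(** The vector part v of z must satisfy cross u v = 0, so it is the multiple
    dot u v *: u of the unit vector u. *)
Lemma commute_pure_unit u z : dot u u = 1 ->
  qmul z (quat 0 u) = qmul (quat 0 u) z ->
  exists s t, z = s *: quat 1 0 + t *: quat 0 u.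
Proof.
rewrite (quat_eta z); move: (qre z) (qim z) => s v u1 /eqP.
have -> : qmul (quat 0 u) (quat s v) =
    qmul (quat s v) (quat 0 u) + 2%:R *: quat 0 (cross u v) by quat_ring.
rewrite -subr_eq0 opprD addNKr oppr_eq0 scaler_eq0 pnatr_eq0 /= => /eqP.
move=> /(congr1 (@qim R)); rewrite qim_quat => uv0.
have uvu0 : cross (cross u v) u = 0.
  by rewrite uv0; apply: row3P; coord_ring.
have : v = dot u v *: u.
  have : cross (cross u v) u = dot u u *: v - dot u v *: u.
    by apply: row3P; coord_ring.
  by rewrite uvu0 u1 scale1r => /esym /eqP; rewrite subr_eq0 => /eqP.
move=> ->; exists s, (dot u v); quat_ring.
Qed.

End Quaternions.

(** * Displacements, Study images and polarity *)

Section Displacements.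
Variable R : realType.
Implicit Types (a b c : displacement R) (p u v X : 'rV[R]_3).
Implicit Types (x y : 'rV[R]_4) (s t : R).

(** The action of Study's mapping, multiplied by x on the right: this removes
    the conjugates and leaves conditions that are linear in (x, y), up to the
    normalisation of x. *)
Definition dual_quaternion_of a x y : Prop :=
  dot x x = 1 /\
  forall p, qmul (quat 0 (a p)) x = qmul x (quat 0 p) + 2%:R *: y.

(** The polar form of the quadratic form dot x y. *)
Definition study_polar x y x' y' : R := dot x y' + dot x' y.

Lemma study_image_dual_quaternion a (V : 'rV[R]_(4 + 4)) : study_image a V ->
  exists k x y,
    [/\ V = k *: row_mx x y, dot x y = 0 & dual_quaternion_of a x y].
Proof.
case=> k [x [y [_ -> x1 xy0 aE]]]; exists k, x, y; split=> //; split=> // p.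
rewrite aE qmulDl qmulZl -!qmulA qmul_conjl x1.
by rewrite !qmul_scalarr !scale1r.
Qed.

Lemma displacement_ext a b : (forall p, a p = b p) -> a = b.
Proof.
move=> ab; have tE : dtrans a = dtrans b.
  by have := ab 0; rewrite /dapp !mul0mx !add0r.
have lE : dlin a = dlin b.
  apply/row_matrixP => k; rewrite !rowE.
  by have := ab (delta_mx 0 k); rewrite /dapp tE => /addIr.
case: a b {ab} tE lE => [A ta oa da] [B tb ob db] /= tE lE.
by subst; congr Displacement; exact: bool_irrelevance.
Qed.

Lemma dual_quaternion_scale_inj s a b x y :
  dual_quaternion_of a x y -> dual_quaternion_of b (s *: x) (s *: y) -> a = b.
Proof.
move=> [x1 aE] [s1 bE]; have s_neq0 : s != 0.
  apply/eqP => s0; have := s1.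
  by rewrite s0 dotZl4 mul0r => /esym/eqP; rewrite oner_eq0.
apply: displacement_ext => p.
have : s *: qmul (quat 0 (b p)) x = s *: qmul (quat 0 (a p)) x.
  by rewrite -qmulZr bE aE scalerDr qmulZl !scalerA mulrC.
move=> /(scalerI s_neq0) /(congr1 (fun q => qmul q (qconj x))).
rewrite -!qmulA qmul_conjr x1 !qmul_scalarr !scale1r.
by move=> /(congr1 (@qim R)); rewrite !qim_quat.
Qed.

(** Take the scalar product of the identity of a at X with x', and of the
    identity of b at X with x.  Left multiplication by the common value a X and
    right multiplication by X are both skew-symmetric, so in the sum only the
    terms with y and y' remain. *)
Lemma common_point_polar0 a b x y x' y' X :
  dual_quaternion_of a x y -> dual_quaternion_of b x' y' -> a X = b X ->
  study_polar x y x' y' = 0.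
Proof.
move=> [_ aE] [_ bE] abX.
have := dot_qmul_pure_left (a X) x x'; rewrite {2}abX aE bE.
rewrite dotDl4 dotDr4 dotZl4 dotZr4 dot_qmul_pure_right (dotC4 y).
set d := dot x (qmul _ _) => dE.
apply: (@mulfI _ 2%:R); first by rewrite pnatr_eq0.
rewrite /study_polar mulr0 mulrDr.
transitivity (- d + 2%:R * dot x' y + (d + 2%:R * dot x y')); first by ring.
by rewrite dE addNr.
Qed.

(** A difference of two values of a moving point involves only the rotation
    part, by which it is conjugated. *)
Lemma dual_quaternionB a x y p q : dual_quaternion_of a x y ->
  qmul (quat 0 (a p) - quat 0 (a q)) x = qmul x (quat 0 (p - q)).
Proof.
case=> _ aE; rewrite quat_pureB -!scaleN1r qmulDl qmulDr qmulZl qmulZr !aE.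
by rewrite scalerDr addrACA !scaleN1r subrr addr0.
Qed.

(** Both rotation parts map the direction u of the line to the same vector, so
    z = x^* x' commutes with u, whence z = s + t u.  Evaluating the identity of
    c at p then gives y'. *)
Lemma dual_quaternion_pencil b c x y x' y' p u : dot u u = 1 ->
  dual_quaternion_of b x y -> dual_quaternion_of c x' y' ->
  b p = c p -> b (p + u) = c (p + u) ->
  exists s t, [/\ s ^+ 2 + t ^+ 2 = 1,
    x' = s *: x + t *: qmul x (quat 0 u) &
    y' = s *: y + t *: (qmul y (quat 0 u) + qmul x (quat 0 (cross p u)))].
Proof.
move=> u1 hb hc bcp bcpu; have [x1 bE] := hb; have [x1' cE] := hc.
have pu_p : p + u - p = u by rewrite addrC addKr.
pose n := quat 0 (b (p + u)) - quat 0 (b p).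
have nx : qmul n x = qmul x (quat 0 u).
  by rewrite /n (dual_quaternionB _ _ hb) pu_p.
have nx' : qmul n x' = qmul x' (quat 0 u).
  by rewrite /n bcp bcpu (dual_quaternionB _ _ hc) pu_p.
pose z := qmul (qconj x) x'.
have xz : x' = qmul x z by rewrite qmulA qmul_conjr x1 qmul_scalarl scale1r.
clearbody z.
have zu : qmul z (quat 0 u) = qmul (quat 0 u) z.
  apply: (qmul_unit_inj x1).
  by rewrite !qmulA -xz -nx' -nx -qmulA -xz.
have [s [t zE]] := commute_pure_unit u1 zu.
have xE : x' = s *: x + t *: qmul x (quat 0 u).
  by rewrite xz zE qmulDr !qmulZr qmul_scalarr scale1r.
exists s, t; split=> //.
  have := x1'; rewrite xz dot_qmul x1 mul1r zE !quatZ quatD dot_quat => <-.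
  have := u1; rewrite !dot3E !mxE => u1'.
  by rewrite -[t ^+ 2]mulr1 -[X in t ^+ 2 * X]u1'; ring.
have := cE p; rewrite -bcp xE qmulDr qmulDl !qmulZr !qmulZl qmulA bE.
rewrite !qmulDl -!qmulA commutator_pure !qmulDr !qmulZr !qmulZl.
(* Up to the terms in x p and x u p, this is twice the equation for y'. *)
move=> E; apply: (@scalerI _ _ 2%:R); first by rewrite pnatr_eq0.
apply: (addrI (s *: qmul x (quat 0 p) +
  t *: qmul x (qmul (quat 0 u) (quat 0 p)))).
rewrite -E; apply/rowP => k; rewrite !mxE; ring.
Qed.

Lemma study_polarDZr s t x y x1 y1 x2 y2 :
  study_polar x y (s *: x1 + t *: x2) (s *: y1 + t *: y2) =
  s * study_polar x y x1 y1 + t * study_polar x y x2 y2.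
Proof. rewrite /study_polar dotDl4 dotDr4 !dotZl4 !dotZr4; ring. Qed.

Lemma join_in_study_quadricC a b :
  join_in_study_quadric a b -> join_in_study_quadric b a.
Proof.
move=> jab v w hv hw z; rewrite -addsmxE addsmxC addsmxE; exact: jab.
Qed.

(** Both Study images lie on the quadric, so on their span the form reduces to
    its mixed term. *)
Lemma polar0_join a b :
  (forall x y x' y', dual_quaternion_of a x y -> dual_quaternion_of b x' y' ->
     study_polar x y x' y' = 0) ->
  join_in_study_quadric a b.
Proof.
move=> polar0 v w /study_image_dual_quaternion[k [x [y [-> xy0 ax]]]].
move=> /study_image_dual_quaternion[k' [x' [y' [-> xy0' bx]]]] z /submxP[D ->].
rewrite -[D]hsubmxK mul_row_col.
rewrite (mx11_scalar (lsubmx D)) (mx11_scalar (rsubmx D)) !mul_scalar_mx.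
rewrite !scalerA !scale_row_mx add_row_mx /study_form row_mxKl row_mxKr.
rewrite dotDl4 !dotDr4 !dotZl4 !dotZr4 xy0 xy0'.
have := polar0 _ _ _ _ ax bx; rewrite /study_polar => pol0.
set e := lsubmx D 0 0 * k; set e' := rsubmx D 0 0 * k'.
transitivity (e * e' * (dot x y' + dot x' y)); first by ring.
by rewrite pol0 mulr0.
Qed.

(** The images of c and c' lie on the same line through the image of b and in
    the polar hyperplane of a.  If B (a, b) were nonzero, their normalised
    coordinates (s, t) and (s', t') on this line would be proportional, hence
    equal up to sign, and the two signs represent the same displacement. *)
Lemma revolute_position_unique a b c c' p u : dot u u = 1 ->
  (exists V, study_image c V) -> (exists V, study_image c' V) ->
  b p = c p -> b (p + u) = c (p + u) ->
  b p = c' p -> b (p + u) = c' (p + u) ->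
  (exists X, a X = c X) -> (exists X, a X = c' X) ->
  ~ join_in_study_quadric a b -> c = c'.
Proof.
move=> u1 [V /study_image_dual_quaternion[_ [xc [yc [_ _ hc]]]]].
move=> [V' /study_image_dual_quaternion[_ [xc' [yc' [_ _ hc']]]]].
move=> bc bcu bc' bcu' [X ac] [X' ac'] nj; apply: contrapT => cc'.
apply: nj; apply: polar0_join => x y x' y' ha hb.
apply/eqP/negP => /negP k_neq0; apply: cc'.
have [s [t [st1 xE yE]]] := dual_quaternion_pencil u1 hb hc bc bcu.
have [s' [t' [st1' xE' yE']]] :=
  dual_quaternion_pencil u1 hb hc' bc' bcu'.
move: yE yE'; set e := qmul y' _ + _; clearbody e => yE yE'.
have := common_point_polar0 ha hc ac.
have := common_point_polar0 ha hc' ac'.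
rewrite xE yE xE' yE' !study_polarDZr => pol' pol.
have det0 : s * t' = s' * t.
  apply: (mulIf k_neq0); apply/eqP; rewrite -subr_eq0; apply/eqP.
  set k := study_polar x y x' y' in pol pol' *.
  set l := study_polar x y _ _ in pol pol' *.
  by transitivity (t' * (s * k + t * l) - t * (s' * k + t' * l));
    [ring | rewrite pol pol'; ring].
(* Since (s, t) has norm 1, the factor of proportionality of two parallel
   vectors is their scalar product. *)
have sE : s' = (s * s' + t * t') * s.
  rewrite -[LHS]mulr1 -st1.
  transitivity (s * s * s' + t * (s' * t)); [ring | rewrite -det0; ring].
have tE : t' = (s * s' + t * t') * t.
  rewrite -[LHS]mulr1 -st1.
  transitivity (s * (s * t') + t * t * t'); [ring | rewrite det0; ring].
apply: (dual_quaternion_scale_inj (s := s * s' + t * t') hc).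
by rewrite xE yE !scalerDr !scalerA -sE -tE -xE' -yE'.
Qed.

Lemma rotation_fixes_base p u w : rotation p u w p = p.
Proof.
rewrite /rotation subrr; apply: row3P; coord_ring.
Qed.

(** Moving the base point along the axis does not affect Rodrigues' formula, so
    a rotation depends only on its oriented axis and its angle. *)
Lemma rotation_line_congr p p' u w X : dot u u = 1 ->
  line p u = line p' u -> rotation p u w X = rotation p' u w X.
Proof.
move=> u1 E; have : line p u p' by rewrite E; exists 0; rewrite scale0r addr0.
case=> t ->; rewrite /rotation.
have -> : cross u (X - (p + t *: u)) = cross u (X - p).
  by apply: row3P; coord_ring.
have -> : dot u (X - (p + t *: u)) = dot u (X - p) - t.
  transitivity (dot u (X - p) - t * dot u u); first by coord_ring.
  by rewrite u1 mulr1.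
apply/rowP => k; rewrite !mxE; ring.
Qed.

End Displacements.

(** * Positions of a rotation quadrangle *)

Section Quadrangles.
Variable R : realType.
Implicit Types (alpha beta : 'I_4 -> displacement R) (i j : 'I_4).

Lemma quadrangle_common_point alpha j : rotation_quadrangle alpha ->
  exists X, alpha j X = alpha (j + 1) X.
Proof.
case=> /(_ j)[p [u [w [_ _ E]]]] _; exists (dinv (alpha j) p).
by rewrite dinvK -dcompE E rotation_fixes_base.
Qed.

Lemma quadrangle_study_image alpha j : rotation_quadrangle alpha ->
  exists V, study_image (alpha j) V.
Proof. by case=> _ [A [hA _ _]]; exists (A j). Qed.

Lemma next_position_unique alpha beta j u w :
  beta j = alpha j -> revolute_axis beta j = revolute_axis alpha j ->
  rotation_angle alpha j u w -> rotation_angle beta j u w ->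
  beta (j + 1) = alpha (j + 1).
Proof.
move=> E axE [u1 [p [ap rp]]] [_ [p' [bp rp']]].
apply: displacement_ext => X.
have : dcomp (dinv (beta j)) (beta (j + 1)) X =
       dcomp (dinv (alpha j)) (alpha (j + 1)) X.
  by rewrite rp rp'; apply: rotation_line_congr; rewrite // -bp -ap.
by rewrite !dcompE E => /(congr1 (alpha j)); rewrite !dinvK.
Qed.

(** The axis r_{j,j+1} pins down position j+1 up to a rotation about it; the
    rotation angle is then fixed by sharing a point with a, which is a linear
    condition on the Study image. *)
Lemma position_determined alpha beta u w j (a : displacement R) :
  rotation_angle alpha j u w ->
  rotation_quadrangle alpha -> rotation_quadrangle beta ->
  beta j = alpha j -> revolute_axis beta j = revolute_axis alpha j ->
  (exists X, a X = beta (j + 1) X) -> (exists X, a X = alpha (j + 1) X) ->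
  ~ join_in_study_quadric a (alpha j) -> beta (j + 1) = alpha (j + 1).
Proof.
move=> [u1 [p [ap _]]] halpha hbeta E axE [X hX] [Y hY] nj.
have p_on : revolute_axis alpha j p.
  by rewrite ap; exists 0; rewrite scale0r addr0.
have pu_on : revolute_axis alpha j (p + u).
  by rewrite ap; exists 1; rewrite scale1r.
have p_onb := p_on; have pu_onb := pu_on.
rewrite -axE /revolute_axis /= E in p_onb pu_onb.
apply: (revolute_position_unique (a := a) (b := alpha j) (p := p) u1) => //.
- exact: quadrangle_study_image.
- exact: quadrangle_study_image.
- by exists X.
- by exists Y.
Qed.

End Quadrangles.

Theorem theorem1 (R : realType) (alpha : 'I_4 -> displacement R)
    (u : 'I_4 -> 'rV[R]_3) (omega : 'I_4 -> R) (i : 'I_4)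
    (halpha : rotation_quadrangle alpha)
    (homega : forall j : 'I_4, rotation_angle alpha j (u j) (omega j))
    (hdiag : ~ join_in_study_quadric (alpha i) (alpha (i + 2%:R))) :
  (forall beta : 'I_4 -> displacement R,
     rotation_quadrangle beta ->
     beta i = alpha i ->
     revolute_axis beta i = revolute_axis alpha i ->
     revolute_axis beta (i + 1) = revolute_axis alpha (i + 1) ->
     revolute_axis beta (i + 2%:R) = revolute_axis alpha (i + 2%:R) ->
     rotation_angle beta i (u i) (omega i) ->
     rotation_angle beta (i + 1) (u (i + 1)) (omega (i + 1)) ->
     forall j : 'I_4, beta j = alpha j)
  /\
  (forall beta : 'I_4 -> displacement R,
     rotation_quadrangle beta ->
     beta i = alpha i ->
     beta (i + 2%:R) = alpha (i + 2%:R) ->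
     revolute_axis beta i = revolute_axis alpha i ->
     revolute_axis beta (i + 2%:R) = revolute_axis alpha (i + 2%:R) ->
     forall j : 'I_4, beta j = alpha j).
Proof.
have i2E : i + 1 + 1 = i + 2%:R by rewrite -addrA.
have i4E : i + 2%:R + 1 + 1 = i.
  have four0 : 2%:R + 1 + 1 = 0 :> 'I_4 by apply/val_inj.
  by rewrite -!(addrA i) four0 addr0.
have positions beta : beta i = alpha i -> beta (i + 1) = alpha (i + 1) ->
    beta (i + 2%:R) = alpha (i + 2%:R) ->
    beta (i + 2%:R + 1) = alpha (i + 2%:R + 1) ->
    forall j, beta j = alpha j.
  move=> e0 e1 e2 e3 j; rewrite -[j](subrK i) addrC.
  case: (j - i) => -[|[|[|[|//]]]] lt_k4.
  - have -> : Ordinal lt_k4 = 0 by apply: val_inj.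
    by rewrite addr0.
  - by have -> : Ordinal lt_k4 = 1 by apply: val_inj.
  - by have -> : Ordinal lt_k4 = 2%:R by apply: val_inj.
  - have -> : Ordinal lt_k4 = 2%:R + 1 by apply: val_inj.
    by rewrite addrA.
have last_position beta : rotation_quadrangle beta -> beta i = alpha i ->
    beta (i + 2%:R) = alpha (i + 2%:R) ->
    revolute_axis beta (i + 2%:R) = revolute_axis alpha (i + 2%:R) ->
    beta (i + 2%:R + 1) = alpha (i + 2%:R + 1).
  move=> hbeta e0 e2 ax.
  have := quadrangle_common_point (i + 2%:R + 1) hbeta.
  have := quadrangle_common_point (i + 2%:R + 1) halpha.
  rewrite i4E e0 => -[X hX] [Y hY].
  apply: (position_determined (homega _) halpha hbeta e2 ax) hdiag.
  - by exists Y.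
  - by exists X.
split=> beta hbeta e0; last first.
  move=> e2 ax0 ax2; apply: positions => //; last exact: last_position.
  have := quadrangle_common_point (i + 1) hbeta.
  have := quadrangle_common_point (i + 1) halpha.
  rewrite i2E e2 => -[X hX] [Y hY].
  apply: (position_determined (a := alpha (i + 2%:R)) (homega i)
    halpha hbeta e0 ax0).
  - by exists Y.
  - by exists X.
  - by move=> /join_in_study_quadricC.
move=> ax0 ax1 ax2 w0 w1.
have e1 := next_position_unique e0 ax0 (homega i) w0.
have e2 := next_position_unique e1 ax1 (homega (i + 1)) w1.
rewrite i2E in e2.
by apply: positions => //; exact: last_position.
Qed.
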